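(* Let $\mathcal Z$ be a convex set, $r:\mathcal Z\to\mathbb{R}$ convex and differentiable, and let $g:\mathcal Z\to\mathcal Z^*$ be a monotone operator that is $\lambda$-relatively Lipschitz with respect to $r$, $\lambda>0$. Let $z_0\in\mathcal Z$, and for $0\le t<T$ let $$w_t=\mathrm{Prox}^r_{z_t}\left(\tfrac1\lambda g(z_t)\right),\qquad z_{t+1}=\mathrm{Prox}^r_{z_t}\left(\tfrac1\lambda g(w_t)\right).$$ Then for all $u\in\mathcal Z$, $$\sum_{0\le t<T}\langle g(w_t),w_t-u\rangle\le\lambda V^r_{z_0}(u).$$
   Context: $\mathcal Z$ is a convex subset of a finite-dimensional real space and $\mathcal Z^*$ denotes the dual space. Bregman divergence: $V^r_z(w)=r(w)-r(z)-\langle\nabla r(z),w-z\rangle$. $\mathrm{Prox}^r_z(\xi)=\mathrm{argmin}_{w\in\mathcal Z}\{\langle\xi,w\rangle+V^r_z(w)\}$, where the minimizers are assumed to exist. $g$ is monotone if $\langle g(w)-g(z),w-z\rangle\ge0$ for all $w,z\in\mathcal Z$. $g$ is $\lambda$-relatively Lipschitz with respect to $r$ if for every three $z,w,u\in\mathcal Z$, $\langle g(w)-g(z),w-u\rangle\le\lambda(V^r_z(w)+V^r_w(u))$. *)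

(* Defs.v *)
From HB Require Import structures.
From mathcomp Require Import all_boot all_order all_algebra.
From mathcomp Require Import all_classical all_reals all_analysis.

Set Implicit Arguments.
Unset Strict Implicit.
Unset Printing Implicit Defensive.

Import Order.TTheory GRing.Theory Num.Theory.
Import numFieldNormedType.Exports.

Local Open Scope classical_set_scope.
Local Open Scope ring_scope.

(* Finite-dimensional normed spaces.  All norms on such a space are
   equivalent, so the norm only serves to make sense of differentiability. *)
#[short(type="normedVectType")]
HB.structure Definition NormedVector (R : realType) :=
  {V of NormedModule R V & Vector R V}.

HB.instance Definition _ (R : realType) (m n : nat) :=
  NormedModule.on 'M[R]_(m, n).

Section RelativeLipschitz.
Context {R : realType} {V : normedVectType R}.
Implicit Types (Z : set V) (r : V -> R) (z w u : V)
  (xi : 'Hom(V, R^o)) (g : V -> 'Hom(V, R^o)).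

(* The dual space is 'Hom(V, R^o), as every linear form on V is continuous, and
   the duality pairing of xi with v is the application xi v. *)

(* A function on Z is represented by a function on V, whose values outside Z
   are never used: here w tends to z inside Z only, with w != z. *)
Definition is_gradient Z r z xi : Prop :=
  (r w - r z - xi (w - z)) / `|w - z| @[w --> within Z z^'] --> (0 : R).

Definition differentiable_on Z r : Prop :=
  forall z, Z z -> exists xi, is_gradient Z r z xi.

(* When Z spans a proper affine subspace the gradient is not unique as an
   element of the dual, but for Z convex and z, w in Z the value
   grad Z r z (w - z) does not depend on the choice made. *)
Definition grad Z r z : 'Hom(V, R^o) := xget 0 (is_gradient Z r z).

Definition bregman Z r z w : R := r w - r z - grad Z r z (w - z).

Definition argmin Z (f : V -> R) : set V :=
  [set w | Z w /\ forall v, Z v -> f w <= f v].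

(* The set of all minimizers: they need not be unique as r is only convex. *)
Definition prox Z r z xi : set V :=
  argmin Z (fun w => xi w + bregman Z r z w).

Definition monotone_operator Z g : Prop :=
  forall w z, Z w -> Z z -> 0 <= (g w - g z) (w - z).

Definition relatively_lipschitz Z r (lambda : R) g : Prop :=
  forall z w u, Z z -> Z w -> Z u ->
    (g w - g z) (w - u)
      <= lambda * (bregman Z r z w + bregman Z r w u).

End RelativeLipschitz.

(* Main.v *)
(** The minimality of a prox point [w] of [z], tested along the segment from [w]
    to [u], gives
      [<xi, w - u> <= V_z(u) - V_w(u) - V_z(w)].
    Applying this to [z_{t+1}] against [u] and to [w_t] against [z_{t+1}], and
    relative Lipschitzness to [z_t], [w_t], [z_{t+1}], all divergences but
    [V_{z_t}(u) - V_{z_{t+1}}(u)] cancel.  The resulting bounds telescope, and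
    [V_{z_T}(u) >= 0] by convexity of [r]. *)

Require Import Defs.
From HB Require Import structures.
From mathcomp Require Import all_boot all_order all_algebra.
From mathcomp Require Import all_classical all_reals all_analysis.
From mathcomp Require Import ring lra.

Import Order.TTheory GRing.Theory Num.Theory.
Import numFieldNormedType.Exports.

Local Open Scope classical_set_scope.
Local Open Scope ring_scope.

Lemma convex_set_segment {R : realType} {V : normedVectType R} {Z : set V}
    {z u : V} {t : R} :
  convex_set Z -> Z z -> Z u -> 0 <= t <= 1 -> Z (z + t *: (u - z)).
Proof.
move=> cZ Zz Zu t01.
pose p : {i01 R} := Itv01 (proj1 (andP t01)) (proj2 (andP t01)).
have := cZ u z p (mem_set Zu) (mem_set Zz).
rewrite inE; congr (Z _); rewrite /conv /= /unstable.onem.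
by rewrite scalerBl scale1r scalerBr addrCA addrA.
Qed.

Lemma convex_function_segment {R : realType} {V : normedVectType R} {Z : set V}
    {r : V -> R} {z u : V} {t : R} :
  convex_function Z r -> Z z -> Z u -> 0 <= t <= 1 ->
  r (z + t *: (u - z)) - r z <= t * (r u - r z).
Proof.
move=> cr Zz Zu t01.
pose p : {i01 R} := Itv01 (proj1 (andP t01)) (proj2 (andP t01)).
have := cr p u z (mem_set Zu) (mem_set Zz).
rewrite convRE /= /unstable.onem.
have -> : conv p (u : convex_lmodType V) z = z + t *: (u - z).
  by rewrite /conv /= /unstable.onem scalerBl scale1r scalerBr addrCA.
lra.
Qed.

(** Convexity keeps the segment from [z] to [u] inside [Z], so the limit defining the gradient can
    be taken along it. This is why [xi (u - z)] is the same for every gradient [xi] at [z]. *)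
Lemma is_gradient_segment {R : realType} {V : normedVectType R} {Z : set V}
    {r : V -> R} {z u : V} {xi : 'Hom(V, R^o)} :
  convex_set Z -> Z z -> Z u -> is_gradient Z r z xi ->
  (r (z + t *: (u - z)) - r z) / t @[t --> 0^'+] --> (xi (u - z) : R).
Proof.
move=> cZ Zz Zu gxi; have [->|uz] := eqVneq u z.
  under eq_fun do rewrite subrr scaler0 addr0 subrr mul0r.
  by rewrite subrr linear0; exact: cvg_cst.
have n0 : `|u - z| != 0 by rewrite normr_eq0 subr_eq0.
(* For [0 < t <= 1] the point lies in [Z], and it differs from [z] because [u != z]. *)
have seg_cvg : z + t *: (u - z) @[t --> 0^'+] --> within Z z^'.
  have c : z + t *: (u - z) @[t --> (0:R)^'+] --> z.
    rewrite -[X in _ --> X]addr0 -[X in _ --> _ + X](scale0r (u - z)).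
    apply: cvgD; first exact: cvg_cst.
    by apply: cvgZl => //; apply: cvg_within_filter; exact: cvg_id.
  move=> A /c hA.
  have {}hA : \forall t \near (0:R)^'+,
    z + t *: (u - z) != z -> Z (z + t *: (u - z)) -> A (z + t *: (u - z)) := hA.
  change (\forall t \near (0:R)^'+, A (z + t *: (u - z))).
  near=> t; have t0 : 0 < t by near: t; exact: nbhs_right_gt.
  apply: (near hA t) => //.
    by rewrite addrC -subr_eq0 addrK scaler_eq0 subr_eq0 (negbTE uz) gt_eqF.
  apply: convex_set_segment => //; rewrite (ltW t0) /=.
  by near: t; exact: nbhs_right_le.
(* For [t > 0] this expression equals the difference quotient, since the denominator is
   [t * |u - z|]; its second term tends to 0. *)
have : (xi (u - z) : R) + `|u - z| *
    ((r (z + t *: (u - z)) - r z - xi (z + t *: (u - z) - z)) /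
      `|z + t *: (u - z) - z|) @[t --> 0^'+] --> (xi (u - z) : R).
  rewrite -[X in _ --> X]addr0 -[X in _ --> _ + X](mulr0 `|u - z|).
  apply: cvgD; first exact: cvg_cst.
  by apply: cvgM; [exact: cvg_cst | exact: cvg_comp _ _ seg_cvg gxi].
apply: cvg_trans; apply: near_eq_cvg.
near=> t; have t0 : 0 < t by near: t; exact: nbhs_right_gt.
rewrite /= (addrC z) addrK normrZ (gtr0_norm t0) linearZ /=.
rewrite /GRing.scale/=; field.
by rewrite n0 gt_eqF.
Unshelve. all: end_near.
Qed.

Lemma grad_is_gradient {R : realType} {V : normedVectType R} {Z : set V}
    {r : V -> R} {z : V} :
  differentiable_on Z r -> Z z -> is_gradient Z r z (grad Z r z).
Proof. by move=> dr /dr; exact: xgetPex. Qed.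

(** By convexity the slopes of [r] along the segment are at most [r u - r z], and so is their limit
    at [z]. *)
Lemma bregman_ge0 {R : realType} {V : normedVectType R} {Z : set V}
    {r : V -> R} {z u : V} :
  convex_set Z -> convex_function Z r -> differentiable_on Z r ->
  Z z -> Z u -> 0 <= bregman Z r z u.
Proof.
move=> cZ cr dr Zz Zu; rewrite /bregman subr_ge0.
have /cvgr_to_le := is_gradient_segment cZ Zz Zu (grad_is_gradient dr Zz).
apply; near=> t.
have t0 : 0 < t by near: t; exact: nbhs_right_gt.
rewrite ler_pdivrMr// mulrC; apply: (convex_function_segment (Z := Z)) => //.
by rewrite (ltW t0) /=; near: t; exact: nbhs_right_le.
Unshelve. all: end_near.
Qed.

Lemma prox_three_point {R : realType} {V : normedVectType R} {Z : set V}
    {r : V -> R} {z w u : V} {xi : 'Hom(V, R^o)} :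
  convex_set Z -> differentiable_on Z r ->
  prox Z r z xi w -> Z u ->
  xi (w - u) <= bregman Z r z u - bregman Z r w u - bregman Z r z w.
Proof.
move=> cZ dr [Zw wmin] Zu.
(* All values of [r] cancel in the three divergences. What remains is the first-order optimality of
   [w] in the direction [u - w]: minimality bounds each difference quotient of [r] at [w] from below
   by the left-hand side. *)
suff : grad Z r z (u - w) - xi (u - w) <= grad Z r w (u - w).
  by rewrite /bregman !linearB /=; lra.
have /cvgr_to_ge := is_gradient_segment cZ Zw Zu (grad_is_gradient dr Zw).
apply; near=> t.
have t0 : 0 < t by near: t; exact: nbhs_right_gt.
have Zv : Z (w + t *: (u - w)).
  apply: convex_set_segment => //.
  by rewrite (ltW t0) /=; near: t; exact: nbhs_right_le.
have lin (eta : 'Hom(V, R^o)) a b : eta (a + t *: b) = eta a + t * eta b :> R.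
  by rewrite linearD linearZ.
have := wmin _ Zv; rewrite ler_pdivlMr// /bregman (addrAC w) !lin.
lra.
Unshelve. all: end_near.
Qed.

Theorem proposition1 (R : realType) (V : normedVectType R) (Z : set V)
    (r : V -> R) (g : V -> 'Hom(V, R^o)) (lambda : R) (T : nat) (z w : nat -> V)
    (Z_convex : convex_set Z)
    (r_convex : convex_function Z r)
    (r_differentiable : differentiable_on Z r)
    (lambda_gt0 : 0 < lambda)
    (g_monotone : monotone_operator Z g)
    (g_lipschitz : relatively_lipschitz Z r lambda g)
    (z0_in : Z (z 0%N))
    (w_step : forall t, (t < T)%N ->
      prox Z r (z t) (lambda^-1 *: g (z t)) (w t))
    (z_step : forall t, (t < T)%N ->
      prox Z r (z t) (lambda^-1 *: g (w t)) (z t.+1)) :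
  forall u, Z u ->
    \sum_(0 <= t < T) g (w t) (w t - u) <= lambda * bregman Z r (z 0%N) u.
Proof.
move=> u Zu.
have Zz t : (t <= T)%N -> Z (z t) by case: t => // t /z_step[].
have linB (xi : 'Hom(V, R^o)) a b : xi (a - b) = xi a - xi b :> R.
  by rewrite linearB.
have step t : (t < T)%N -> g (w t) (w t - u) <=
    lambda * bregman Z r (z t) u - lambda * bregman Z r (z t.+1) u.
  move=> tT; have Zz1 := Zz _ tT; have [Zw _] := w_step _ tT.
  have := prox_three_point Z_convex r_differentiable (z_step _ tT) Zu.
  have := prox_three_point Z_convex r_differentiable (w_step _ tT) Zz1.
  have := g_lipschitz _ _ _ (Zz _ (ltnW tT)) Zw Zz1.
  (* With [z' = z t.+1], the left-hand side splits as [(g (w t) - g (z t)) (w t - z') + g (z t) (w t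
     - z') + g (w t) (z' - u)], one term for each bound. *)
  rewrite !scale_lfunE add_lfunE opp_lfunE /GRing.scale /=.
  by rewrite !(mulrC lambda^-1) !ler_pdivrMr// !linB; lra.
apply: le_trans (ler_sum_nat (fun t tT => step t (proj2 (andP tT)))) _.
(* The sign turns the decreasing differences into the form [f t.+1 - f t]. *)
rewrite (telescope_sumr_eq (fun t => - (lambda * bregman Z r (z t) u))) //;
  last by move=> t _; rewrite opprK addrC.
rewrite opprK addrC gerDl oppr_le0 mulr_ge0 ?(ltW lambda_gt0)//.
exact: bregman_ge0 (Zz _ (leqnn T)) Zu.
Qed.
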